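(* Let $n\ge2$, $a,b\in\mathbb{R}^n$ and let $Q\in\mathbb{R}^{n\times n}$ be symmetric positive semidefinite. Suppose that, for all $y\in\mathbb{R}^n$, $$y'Qy=y'Dy+\sum_{(i,j)\in\mathcal P}\alpha_{ij}\left(\beta_{ij}y_i^2+2y_iy_j+\gamma_{ij}y_j^2\right)+\sum_{(i,j)\in\mathcal N}\alpha_{ij}\left(\beta_{ij}y_i^2-2y_iy_j+\gamma_{ij}y_j^2\right)+y'Ry,$$ where $D$ is a diagonal positive semidefinite matrix, $R$ is a symmetric positive semidefinite matrix, $\mathcal P$ and $\mathcal N$ are disjoint sets of pairs $(i,j)$ with $1\le i<j\le n$, and for every $(i,j)\in\mathcal P\cup\mathcal N$, $\alpha_{ij}>0$ and $(\beta_{ij},\gamma_{ij})\in\mathcal D$. Let (Decomp) be the relaxation of (QI) $$\begin{aligned}\min_{x,y}\ & a'x+b'y+\sum_{i=1}^nD_{ii}\frac{y_i^2}{x_i}+\sum_{(i,j)\in\mathcal P}\alpha_{ij}f_+^*(x_i,x_j,y_i,y_j;\beta_{ij},\gamma_{ij})\\ &\quad+\sum_{(i,j)\in\mathcal N}\alpha_{ij}f_-^*(x_i,x_j,y_i,y_j;\beta_{ij},\gamma_{ij})+y'Ry\\ \text{s.t. }& 0\le x\le1,\ y\ge0.\end{aligned}$$ Then the relaxation (OptPairs) of (QI) is at least as strong as (Decomp).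
   Context: A prime denotes transpose, $\langle Q,Y\rangle=\sum_{i,j}Q_{ij}Y_{ij}$, and $A\succeq0$ means symmetric positive semidefinite. (QI): $\min\{a'x+b'y+y'Qy:(x,y)\in\mathcal I_n\}$, $\mathcal I_n=\{(x,y)\in\{0,1\}^n\times\mathbb{R}^n_+: y_i(1-x_i)=0,\ i=1,\dots,n\}$. (OptPairs): minimize $a'x+b'y+\langle Q,Y\rangle$ over $x,y\in\mathbb{R}^n$ and symmetric $Y\in\mathbb{R}^{n\times n}$ subject to $Y-yy'\succeq0$; $(x_i,x_j,y_i,y_j,Y_{ii},Y_{ij},Y_{jj})\in\mathcal W$ for all $1\le i<j\le n$; $0\le x\le1$; $y\ge0$. Here $\mathcal W$ is the set of points $(x_1,x_2,y_1,y_2,Y_{11},Y_{12},Y_{22})$ for which there exists a symmetric $3\times3$ matrix $W\succeq 0$ with - $W_{12}=Y_{12}$; - $(Y_{11}-W_{11})(x_1-W_{33})\ge(y_1-W_{31})^2$, $W_{11}\le Y_{11}$, $W_{33}\le x_1$; - $(Y_{22}-W_{22})(x_2-W_{33})\ge(y_2-W_{32})^2$, $W_{22}\le Y_{22}$, $W_{33}\le x_2$; - $0\le W_{31}\le y_1$, $0\le W_{32}\le y_2$; - $W_{33}\ge x_1+x_2-1$. $\mathcal D=\{d\in\mathbb{R}^2:d_1\ge0,\ d_2\ge 0,\ d_1d_2\ge1\}$. For $x\in[0,1]^2$, $y\in\mathbb{R}^2_+$, $d\in\mathcal D$, $$f_+^*(x,y;d)=\min_{z,\lambda}\left\{\tfrac{d_1(y_1-z_1)^2}{x_1-\lambda}+\tfrac{d_2(y_2-z_2)^2}{x_2-\lambda}+\tfrac{d_1z_1^2+2z_1z_2+d_2z_2^2}{\lambda}: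 z_1\ge0,\ z_2\ge0,\ \max\{0,x_1+x_2-1\}\le\lambda\le\min\{x_1,x_2\}\right\},$$ $$f_-^*(x,y;d)=\min_{z,\lambda}\left\{\tfrac{d_1(y_1-z_1)^2}{x_1-\lambda}+\tfrac{d_2(y_2-z_2)^2}{x_2-\lambda}+\tfrac{d_1z_1^2-2z_1z_2+d_2z_2^2}{\lambda}: z_1\le y_1,\ z_2\le y_2,\ \max\{0,x_1+x_2-1\}\le\lambda\le\min\{x_1,x_2\}\right\},$$ with $z\in\mathbb{R}^2$, values in $[0,+\infty]$, and the convention (used also for $y_i^2/x_i$) that for a nonnegative numerator $q$, $q/0=+\infty$ if $q\neq0$ and $q/0=0$ if $q=0$; also $0\cdot(+\infty)=0$ for a zero coefficient $D_{ii}$. ''At least as strong'' means: the optimal value (infimum) of (OptPairs) is at least the optimal value (infimum) of (Decomp). *)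

(* Defs.v *)
From HB Require Import structures.
From mathcomp Require Export all_boot all_order all_algebra.
From mathcomp Require Export boolp classical_sets reals ereal.

Set Implicit Arguments.
Unset Strict Implicit.
Unset Printing Implicit Defensive.

Import Order.TTheory GRing.Theory Num.Theory.
Local Open Scope classical_set_scope.
Local Open Scope ring_scope.

Definition dotv (R : realType) (n : nat) (u v : 'cV[R]_n) : R :=
  (u^T *m v) 0 0.

Definition qform (R : realType) (n : nat) (A : 'M[R]_n) (y : 'cV[R]_n) : R :=
  (y^T *m A *m y) 0 0.

Definition frob (R : realType) (n : nat) (A B : 'M[R]_n) : R :=
  \sum_(i < n) \sum_(j < n) A i j * B i j.

Definition psdmx (R : realType) (n : nat) (A : 'M[R]_n) : Prop :=
  A \is symmetricmx /\ forall v : 'cV[R]_n, 0 <= qform A v.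

(* 1-based indices of a 3 x 3 matrix. *)
Definition k1 : 'I_3 := @Ordinal 3 0 isT.
Definition k2 : 'I_3 := @Ordinal 3 1 isT.
Definition k3 : 'I_3 := @Ordinal 3 2 isT.

Definition calW (R : realType) (x1 x2 y1 y2 Y11 Y12 Y22 : R) : Prop :=
  exists W : 'M[R]_3,
    psdmx W /\ W k1 k2 = Y12 /\
    [/\ (Y11 - W k1 k1) * (x1 - W k3 k3) >= (y1 - W k3 k1) ^+ 2,
        W k1 k1 <= Y11 & W k3 k3 <= x1] /\
    [/\ (Y22 - W k2 k2) * (x2 - W k3 k3) >= (y2 - W k3 k2) ^+ 2,
        W k2 k2 <= Y22 & W k3 k3 <= x2] /\
    [/\ 0 <= W k3 k1 <= y1, 0 <= W k3 k2 <= y2 & x1 + x2 - 1 <= W k3 k3].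

Definition box_feasible (R : realType) (n : nat) (x y : 'cV[R]_n) : Prop :=
  forall i : 'I_n, 0 <= x i 0 <= 1 /\ 0 <= y i 0.

Definition optpairs_feasible (R : realType) (n : nat)
    (x y : 'cV[R]_n) (Y : 'M[R]_n) : Prop :=
  [/\ Y \is symmetricmx,
      psdmx (Y - y *m y^T),
      forall i j : 'I_n, (i < j)%N ->
        calW (x i 0) (x j 0) (y i 0) (y j 0) (Y i i) (Y i j) (Y j j) &
      box_feasible x y].

Definition optpairs_val (R : realType) (n : nat)
    (a b : 'cV[R]_n) (Q : 'M[R]_n) : \bar R :=
  ereal_inf [set v | exists x y : 'cV[R]_n, exists Y : 'M[R]_n,
    optpairs_feasible x y Y /\ v = (dotv a x + dotv b y + frob Q Y)%:E].

Definition calD (R : realType) : set (R * R) :=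
  [set d | [/\ 0 <= d.1, 0 <= d.2 & 1 <= d.1 * d.2]].

Definition lambda_range (R : realType) (x1 x2 l : R) : Prop :=
  Num.max 0 (x1 + x2 - 1) <= l <= Num.min x1 x2.

(* Division in \bar R satisfies 0^-1 = +oo and 0 * +oo = 0, so that for q >= 0
   the quotient q%:E / 0%:E is 0 if q = 0 and +oo otherwise. On the ranges
   below no denominator is negative, and for d in calD no numerator is. *)
Definition fplus_obj (R : realType) (y1 y2 d1 d2 x1 x2 z1 z2 l : R) : \bar R :=
  ((d1 * (y1 - z1) ^+ 2)%:E / (x1 - l)%:E
   + (d2 * (y2 - z2) ^+ 2)%:E / (x2 - l)%:E
   + (d1 * z1 ^+ 2 + 2 * z1 * z2 + d2 * z2 ^+ 2)%R%:E / l%:E)%E.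

Definition fminus_obj (R : realType) (y1 y2 d1 d2 x1 x2 z1 z2 l : R) : \bar R :=
  ((d1 * (y1 - z1) ^+ 2)%:E / (x1 - l)%:E
   + (d2 * (y2 - z2) ^+ 2)%:E / (x2 - l)%:E
   + (d1 * z1 ^+ 2 - 2 * z1 * z2 + d2 * z2 ^+ 2)%R%:E / l%:E)%E.

Definition fplus (R : realType) (x1 x2 y1 y2 d1 d2 : R) : \bar R :=
  ereal_inf [set v | exists z1 z2 l : R,
    [/\ 0 <= z1, 0 <= z2, lambda_range x1 x2 l &
        v = fplus_obj y1 y2 d1 d2 x1 x2 z1 z2 l]].

(* z is bounded above by y only; its components may be negative. *)
Definition fminus (R : realType) (x1 x2 y1 y2 d1 d2 : R) : \bar R :=
  ereal_inf [set v | exists z1 z2 l : R,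
    [/\ z1 <= y1, z2 <= y2, lambda_range x1 x2 l &
        v = fminus_obj y1 y2 d1 d2 x1 x2 z1 z2 l]].

(* The case D i i = 0 with y_i^2 / x_i = +oo contributes 0 * +oo = 0. *)
Definition decomp_obj (R : realType) (n : nat) (a b : 'cV[R]_n)
    (D Rm : 'M[R]_n) (P N : {set 'I_n * 'I_n})
    (alpha beta gamma : 'I_n -> 'I_n -> R) (x y : 'cV[R]_n) : \bar R :=
  ((dotv a x + dotv b y)%R%:E
   + \sum_(i < n) (D i i)%:E * ((y i 0%R ^+ 2)%:E / (x i 0%R)%:E)
   + \sum_(p in P) (alpha p.1 p.2)%:E *
       fplus (x p.1 0%R) (x p.2 0%R) (y p.1 0%R) (y p.2 0%R)
             (beta p.1 p.2) (gamma p.1 p.2)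
   + \sum_(p in N) (alpha p.1 p.2)%:E *
       fminus (x p.1 0%R) (x p.2 0%R) (y p.1 0%R) (y p.2 0%R)
              (beta p.1 p.2) (gamma p.1 p.2)
   + (qform Rm y)%:E)%E.

Definition decomp_val (R : realType) (n : nat) (a b : 'cV[R]_n)
    (D Rm : 'M[R]_n) (P N : {set 'I_n * 'I_n})
    (alpha beta gamma : 'I_n -> 'I_n -> R) : \bar R :=
  ereal_inf [set v | exists x y : 'cV[R]_n,
    box_feasible x y /\ v = decomp_obj a b D Rm P N alpha beta gamma x y].

(* Main.v *)
Require Import Defs.
From mathcomp Require Import all_boot all_order all_algebra.
From mathcomp Require Import boolp classical_sets reals ereal.
From mathcomp Require Import ring lra.
Import Order.TTheory GRing.Theory Num.Theory.
Local Open Scope ring_scope.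

(** Every feasible point [(x, y, Y)] of (OptPairs) yields the feasible point
    [(x, y)] of (Decomp) with an objective value that is no larger; this gives
    the inequality between the two infima.

    The matrix [Y - y *m y^T] is positive semidefinite, hence a sum of outer
    products [v *m v^T] ([psd_sum_outer]), and so is [Y], with [y] as one more
    vector. Summing the identity of quadratic forms over these vectors turns
    it into a decomposition of [frob Q Y] ([frob_decomposition]), and
    [frob Rm Y >= qform Rm y] because the vectors other than [y] contribute
    nonnegative terms. It remains to compare the other terms one by one.

    The term of an entry of [D] requires [y_i ^+ 2 <= Y_ii * x_i]. Together with
    a partner index [j], the membership in [calW] splits [(Y_ii, y_i, x_i)] into
    a part coming from [W] and a remainder, each satisfying such an inequality,
    and these inequalities add up ([calW_diag]).

    The term of a pair in [P] or [N] is bounded by taking the point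
    [z = (W31, W32)], [l = W33] in the minimization problem defining [fplus] or
    [fminus] ([fplus_le], [fminus_le]). The remainders of [calW] bound the first
    two quotients. For the third one, the Schur complement of [W33] in [W] is
    positive semidefinite, and so is [(d1, s; s, d2)] for [(d1, d2)] in [calD]
    and [s] equal to [1] or [-1], so that the Frobenius product of the two is
    nonnegative ([perspective_pair_le]); if [W33 = 0], then [z = 0] and the
    quotient vanishes. *)

(** * The Cauchy-Schwarz inequality for positive semidefinite matrices *)

Lemma discriminant_le {R : realType} (a b c : R) :
  0 <= c -> (forall t, 0 <= a + 2 * b * t + c * t ^+ 2) -> b ^+ 2 <= a * c.
Proof.
move=> c_ge0 nonneg; have [c0|c_neq0] := eqVneq c 0.
  have [->|b_neq0] := eqVneq b 0; first by rewrite c0 expr0n mulr0.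
  (* at this point the affine function a + 2 b t takes the value -1 *)
  have := nonneg (- (a + 1) / (2 * b)).
  by have -> : 2 * b * (- (a + 1) / (2 * b)) = - (a + 1);
    [field | rewrite c0 mul0r => ?; lra].
have c_gt0 : 0 < c by rewrite lt_def c_neq0.
have := nonneg (- b / c).
rewrite -(ler_pM2r c_gt0) mul0r.
have -> : (a + 2 * b * (- b / c) + c * (- b / c) ^+ 2) * c = a * c - b ^+ 2.
  by field.
by rewrite subr_ge0.
Qed.

Definition bform {R : realType} {n : nat} (A : 'M[R]_n) (u v : 'cV[R]_n) : R :=
  (u^T *m A *m v) 0 0.

Lemma qformE {R : realType} {n : nat} (A : 'M[R]_n) u : qform A u = bform A u u.
Proof. by []. Qed.

Lemma bformDr {R : realType} {n : nat} (A : 'M[R]_n) u v w :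
  bform A u (v + w) = bform A u v + bform A u w.
Proof. by rewrite /bform mulmxDr mxE. Qed.

Lemma bformDl {R : realType} {n : nat} (A : 'M[R]_n) u v w :
  bform A (u + v) w = bform A u w + bform A v w.
Proof. by rewrite /bform linearD /= !mulmxDl mxE. Qed.

Lemma bformZr {R : realType} {n : nat} (A : 'M[R]_n) u c v :
  bform A u (c *: v) = c * bform A u v.
Proof. by rewrite /bform -scalemxAr mxE. Qed.

Lemma bformZl {R : realType} {n : nat} (A : 'M[R]_n) c u v :
  bform A (c *: u) v = c * bform A u v.
Proof. by rewrite /bform linearZ /= -!scalemxAl mxE. Qed.

Lemma bform_delta {R : realType} {n : nat} (A : 'M[R]_n) i v :
  bform A (delta_mx i 0) v = (A *m v) i 0.
Proof. by rewrite /bform -mulmxA trmx_delta -rowE mxE. Qed.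

Lemma bform_delta2 {R : realType} {n : nat} (A : 'M[R]_n) i j :
  bform A (delta_mx i 0) (delta_mx j 0) = A i j.
Proof. by rewrite bform_delta -colE mxE. Qed.

Lemma qform_delta {R : realType} {n : nat} (A : 'M[R]_n) i :
  qform A (delta_mx i 0) = A i i.
Proof. exact: bform_delta2. Qed.

Lemma symmetricmx_tr {R : realType} {n : nat} (A : 'M[R]_n) :
  A \is symmetricmx -> A^T = A.
Proof. by move/is_hermitianmxP; rewrite expr0 scale1r map_mx_id. Qed.

Lemma tr_symmetricmx {R : realType} {n : nat} (A : 'M[R]_n) :
  A^T = A -> A \is symmetricmx.
Proof. by move=> At; apply/is_hermitianmxP; rewrite expr0 scale1r map_mx_id. Qed.

Lemma bform_sym {R : realType} {n : nat} (A : 'M[R]_n) u v :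
  A \is symmetricmx -> bform A u v = bform A v u.
Proof.
move=> /symmetricmx_tr At.
have tr11 (B : 'M[R]_1) : B 0 0 = B^T 0 0 by rewrite mxE.
by rewrite /bform tr11 !trmx_mul trmxK At mulmxA.
Qed.

(** The quadratic polynomial [t |-> qform A (u + t *: v)] is nonnegative, so
    its discriminant is at most zero. *)
Lemma psd_cauchy_schwarz {R : realType} {n : nat} (A : 'M[R]_n) u v :
  psdmx A -> bform A u v ^+ 2 <= qform A u * qform A v.
Proof.
move=> [Asym Ape]; apply: discriminant_le => [|t]; first exact: Ape.
suff -> : qform A u + 2 * bform A u v * t + qform A v * t ^+ 2 =
          qform A (u + t *: v) by exact: Ape.
rewrite !qformE !bformDr !bformDl !bformZr !bformZl (bform_sym A v u) //; ring.
Qed.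

Lemma psd_diag_ge0 {R : realType} {n : nat} (A : 'M[R]_n) i :
  psdmx A -> 0 <= A i i.
Proof. by move=> [_ Ape]; rewrite -qform_delta; exact: Ape. Qed.

(** * Positive semidefinite matrices are sums of outer products *)

Lemma qform_outer {R : realType} {n : nat} (v u : 'cV[R]_n) :
  qform (v *m v^T) u = (v^T *m u) 0 0 ^+ 2.
Proof.
rewrite /qform mulmxA -mulmxA mxE big_ord1 expr2; congr (_ * _).
by rewrite -[in LHS](trmxK v) -trmx_mul mxE.
Qed.

(** One step of a Cholesky factorization. At a vector [u] the subtracted form
    is [bform A e_k u ^+ 2 / A k k], so that Cauchy-Schwarz for the k-th basis
    vector [e_k] and [u] is exactly the semidefiniteness of what remains. *)
Lemma psd_deflate {R : realType} {n : nat} (A : 'M[R]_n) k :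
  psdmx A -> 0 < A k k ->
  let v := (Num.sqrt (A k k))^-1 *: col k A in
  psdmx (A - v *m v^T) /\ (v *m v^T) k k = A k k.
Proof.
move=> psdA Akk_gt0 v; have [Asym _] := psdA; have At := symmetricmx_tr A Asym.
have sq : (Num.sqrt (A k k))^-1 ^+ 2 = (A k k)^-1.
  by rewrite exprVn sqr_sqrtr // ltW.
split; last first.
  rewrite mxE big_ord1 !mxE -expr2 exprMn sq expr2 mulKf //; exact: lt0r_neq0.
split.
  by apply: tr_symmetricmx; rewrite linearB /= trmx_mul trmxK At.
move=> u.
have -> : qform (A - v *m v^T) u = qform A u - bform A (delta_mx k 0) u ^+ 2 / A k k.
  rewrite /qform mulmxBr mulmxBl mxE [X in _ + X]mxE; congr (_ - _).
  rewrite -/(qform _ u) qform_outer linearZ /= -scalemxAl mxE exprMn sq mulrC.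
  by rewrite bform_delta tr_col At -row_mul mxE.
rewrite subr_ge0 ler_pdivrMr // mulrC -(qform_delta A).
exact: psd_cauchy_schwarz.
Qed.

Lemma psd_diag0 {R : realType} {n : nat} (A : 'M[R]_n) :
  psdmx A -> (forall i, A i i = 0) -> A = 0.
Proof.
move=> psdA diag0; apply/matrixP => i j; rewrite mxE.
have := psd_cauchy_schwarz A (delta_mx i 0) (delta_mx j 0) psdA.
rewrite bform_delta2 qform_delta diag0 mul0r => le0.
by apply/eqP; rewrite -sqrf_eq0 eq_le le0 sqr_ge0.
Qed.

(** Subtracting the outer product of [psd_deflate] kills one diagonal entry
    without enlarging the others, so the number of nonzero diagonal entries
    drops; a matrix with zero diagonal vanishes by [psd_diag0]. This replaces
    a spectral decomposition: no eigenvectors are needed, only some way of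
    writing [A] as a sum of outer products. *)
Lemma psd_sum_outer {R : realType} {n : nat} (A : 'M[R]_n) :
  psdmx A -> exists vs : seq 'cV[R]_n, A = \sum_(v <- vs) v *m v^T.
Proof.
have [m] := ubnP #|[set i | A i i != 0]|.
elim: m A => // m IHm A lt_m psdA.
have [diag0|] := boolP [forall i, A i i == 0].
  exists [::]; rewrite big_nil; apply: psd_diag0 => // i.
  exact/eqP/(forallP diag0).
rewrite negb_forall => /existsP[k Akk_neq0].
have Akk_gt0 : 0 < A k k by rewrite lt_def Akk_neq0 psd_diag_ge0.
have [] := psd_deflate A k psdA Akk_gt0.
set v := _ *: _ => psdB vvk.
have [|vs Bvs] := IHm (A - v *m v^T) _ psdB.
  rewrite -ltnS; apply: leq_trans lt_m; rewrite ltnS; apply: proper_card.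
  apply/properP; split; last first.
    exists k; rewrite inE //.
    by rewrite mxE [X in _ + X]mxE vvk subrr eqxx.
  apply/fintype.subsetP => i; rewrite !inE; apply: contra_neq => Aii0.
  apply/eqP; rewrite eq_le psd_diag_ge0 // andbT mxE [X in _ + X]mxE Aii0.
  by rewrite sub0r oppr_le0 -qform_delta qform_outer sqr_ge0.
by exists (v :: vs); rewrite big_cons -Bvs addrC subrK.
Qed.

(** * Bounds on one pair of indices *)

(** Clears a denominator that may vanish: when [l = 0], the last hypothesis
    forces [q = 0], and then the quotient is [0 * +oo = 0]. *)
Lemma lee_div_fin {R : realType} (q l c : R) :
  0 <= q -> 0 <= l -> 0 <= c -> q <= c * l -> (q%:E / l%:E <= c%:E)%E.
Proof.
move=> q_ge0 l_ge0 c_ge0 q_le; rewrite inver; case: eqP => [l0|/eqP l_neq0].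
  have -> : q = 0 by apply/eqP; rewrite eq_le q_ge0 andbT; rewrite l0 mulr0 in q_le.
  by rewrite mul0e lee_fin.
by rewrite -EFinM lee_fin ler_pdivrMr // lt_def l_neq0.
Qed.

Lemma lee_scaled_div {R : realType} (d r l Y W : R) :
  0 <= d -> r ^+ 2 <= (Y - W) * l -> W <= Y -> 0 <= l ->
  ((d * r ^+ 2)%:E / l%:E <= (d * (Y - W))%:E)%E.
Proof.
move=> d_ge0 r_le WY l_ge0; apply: lee_div_fin => //.
- by rewrite mulr_ge0 ?sqr_ge0.
- by rewrite mulr_ge0 ?subr_ge0.
- by rewrite -mulrA ler_wpM2l.
Qed.

(** Cauchy-Schwarz for the third basis vector and [(p, r, 0)]: the
    Schur complement of [W33] in [W] is positive semidefinite, stated without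
    dividing by [W33], which may vanish. *)
Lemma psd3_cauchy_schwarz {R : realType} (W : 'M[R]_3) (p r : R) :
  psdmx W ->
  (p * W k3 k1 + r * W k3 k2) ^+ 2
    <= W k3 k3 * (p ^+ 2 * W k1 k1 + 2 * p * r * W k1 k2 + r ^+ 2 * W k2 k2)
  /\ 0 <= p ^+ 2 * W k1 k1 + 2 * p * r * W k1 k2 + r ^+ 2 * W k2 k2.
Proof.
move=> psdW; have [Wsym Wpe] := psdW.
pose v : 'cV[R]_3 := p *: delta_mx k1 0 + r *: delta_mx k2 0.
have <- : qform W v = p ^+ 2 * W k1 k1 + 2 * p * r * W k1 k2 + r ^+ 2 * W k2 k2.
  rewrite qformE bformDr !bformDl !bformZl !bformZr.
  rewrite (bform_sym W (delta_mx k2 0) (delta_mx k1 0)) // !bform_delta2.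
  ring.
split; last exact: Wpe.
have <- : bform W (delta_mx k3 0) v = p * W k3 k1 + r * W k3 k2.
  by rewrite bformDr !bformZr !bform_delta2.
by rewrite -(qform_delta W); exact: psd_cauchy_schwarz.
Qed.

(** Multiplying by [d1], which is positive on [calD], and completing the square
    splits the form [(d1, s; s, d2)] into the square of [(d1, s)] and
    [d1 * d2 - 1 >= 0] times the square of the second coordinate. On both parts
    Cauchy-Schwarz compares the numerator with [W33] times the bound. The sign
    [s] is [1] for [fplus] and [-1] for [fminus]. *)
Lemma perspective_pair_le {R : realType} (d1 d2 s : R) (W : 'M[R]_3) :
  calD (d1, d2) -> s ^+ 2 = 1 -> psdmx W ->
  ((d1 * W k3 k1 ^+ 2 + s * (2 * W k3 k1 * W k3 k2) + d2 * W k3 k2 ^+ 2)%:E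
     / (W k3 k3)%:E
   <= (d1 * W k1 k1 + s * (2 * W k1 k2) + d2 * W k2 k2)%:E)%E.
Proof.
move=> [/= d1_ge0 d2_ge0 d12] s2 psdW.
have d1_gt0 : 0 < d1.
  rewrite lt_def d1_ge0 andbT; apply/eqP => d10; move: d12.
  by rewrite d10 mul0r ler10.
have [cs1 pos1] := psd3_cauchy_schwarz W d1 s psdW.
have [cs2 _] := psd3_cauchy_schwarz W 0 1 psdW.
have W22 : 0 <= W k2 k2 by exact: psd_diag_ge0.
have W33 : 0 <= W k3 k3 by exact: psd_diag_ge0.
have d12_ge0 : 0 <= d1 * d2 - 1 by rewrite subr_ge0.
set z1 := W k3 k1 in cs1 cs2 *; set z2 := W k3 k2 in cs1 cs2 *.
set l := W k3 k3 in W33 cs1 cs2 *.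
have cs2' : 0 <= W k2 k2 * l - z2 ^+ 2 by rewrite subr_ge0; nra.
apply: lee_div_fin => //; rewrite -(ler_pM2l d1_gt0) ?mulr0.
- have -> : d1 * (d1 * z1 ^+ 2 + s * (2 * z1 * z2) + d2 * z2 ^+ 2) =
    (d1 * z1 + s * z2) ^+ 2 + (d1 * d2 - 1) * z2 ^+ 2 + (1 - s ^+ 2) * z2 ^+ 2.
    by ring.
  by rewrite s2 subrr mul0r addr0 addr_ge0 ?sqr_ge0 ?(mulr_ge0 d12_ge0) ?sqr_ge0.
- have -> : d1 * (d1 * W k1 k1 + s * (2 * W k1 k2) + d2 * W k2 k2) =
    (d1 ^+ 2 * W k1 k1 + 2 * d1 * s * W k1 k2 + s ^+ 2 * W k2 k2)
    + (d1 * d2 - 1) * W k2 k2 + (1 - s ^+ 2) * W k2 k2 by ring.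
  by rewrite {2}s2 subrr mul0r addr0 addr_ge0 // mulr_ge0.
- rewrite -subr_ge0.
  rewrite [leRHS](_ : _ =
    (l * (d1 ^+ 2 * W k1 k1 + 2 * d1 * s * W k1 k2 + s ^+ 2 * W k2 k2)
      - (d1 * z1 + s * z2) ^+ 2)
    + (d1 * d2 - 1) * (W k2 k2 * l - z2 ^+ 2)
    + (1 - s ^+ 2) * (W k2 k2 * l - z2 ^+ 2)); last by ring.
  by rewrite {2}s2 subrr mul0r addr0 addr_ge0 ?subr_ge0 // mulr_ge0.
Qed.

(** The 2 x 2 matrices [(A, p; p, B)] and [(C, q; q, E)] are positive
    semidefinite, hence so is their sum, whose determinant is nonnegative. The
    mixed terms are compared by the arithmetic-geometric mean inequality. *)
Lemma sqrrD_le_prod {R : realType} (p q A B C E : R) :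
  0 <= A -> 0 <= B -> 0 <= C -> 0 <= E ->
  p ^+ 2 <= A * B -> q ^+ 2 <= C * E -> (p + q) ^+ 2 <= (A + C) * (B + E).
Proof.
move=> A0 B0 C0 E0 pAB qCE.
have AE0 : 0 <= A * E by exact: mulr_ge0.
have CB0 : 0 <= C * B by exact: mulr_ge0.
have cross : 2 * p * q <= A * E + C * B.
  apply: le_trans (ler_norm _) _; rewrite -ler_sqr ?nnegrE ?addr_ge0 //.
  rewrite real_normK ?num_real //.
  have pq : p ^+ 2 * q ^+ 2 <= (A * B) * (C * E) by rewrite ler_pM ?sqr_ge0.
  have := sqr_ge0 (A * E - C * B); nra.
by nra.
Qed.

(** The inequality [y1 ^+ 2 <= Y11 * x1] results from adding the one that [W]
    satisfies, [W31 ^+ 2 <= W11 * W33], to the one required of the remainder. *)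
Lemma calW_diag {R : realType} {x1 x2 y1 y2 Y11 Y12 Y22 : R} :
  calW x1 x2 y1 y2 Y11 Y12 Y22 ->
  [/\ 0 <= Y11, 0 <= Y22, y1 ^+ 2 <= Y11 * x1 & y2 ^+ 2 <= Y22 * x2].
Proof.
move=> [W [psdW [_ [[c1 W11 l1] [[c2 W22 l2] _]]]]].
have [W11_ge0 W22_ge0 W33_ge0] : [/\ 0 <= W k1 k1, 0 <= W k2 k2 & 0 <= W k3 k3].
  by split; exact: psd_diag_ge0.
have [cs1 _] := psd3_cauchy_schwarz W 1 0 psdW.
have [cs2 _] := psd3_cauchy_schwarz W 0 1 psdW.
split; [lra|lra| |].
- have := sqrrD_le_prod (y1 - W k3 k1) (W k3 k1) (Y11 - W k1 k1)
    (x1 - W k3 k3) (W k1 k1) (W k3 k3).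
  rewrite !subrK !subr_ge0; apply => //; nra.
- have := sqrrD_le_prod (y2 - W k3 k2) (W k3 k2) (Y22 - W k2 k2)
    (x2 - W k3 k3) (W k2 k2) (W k3 k3).
  rewrite !subrK !subr_ge0; apply => //; nra.
Qed.

(** The witness [W] gives the point [z = (W31, W32)], [l = W33] of the problems
    defining [fplus] and [fminus]. The first two quotients use up
    [d1 * (Y11 - W11)] and [d2 * (Y22 - W22)], and the third one the form in
    the entries of [W]. *)
Lemma pair_obj_le {R : realType} (d1 d2 s x1 x2 y1 y2 Y11 Y22 : R) (W : 'M[R]_3) :
  calD (d1, d2) -> s ^+ 2 = 1 -> psdmx W ->
  (y1 - W k3 k1) ^+ 2 <= (Y11 - W k1 k1) * (x1 - W k3 k3) ->
  W k1 k1 <= Y11 -> W k3 k3 <= x1 ->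
  (y2 - W k3 k2) ^+ 2 <= (Y22 - W k2 k2) * (x2 - W k3 k3) ->
  W k2 k2 <= Y22 -> W k3 k3 <= x2 ->
  ((d1 * (y1 - W k3 k1) ^+ 2)%:E / (x1 - W k3 k3)%:E
   + (d2 * (y2 - W k3 k2) ^+ 2)%:E / (x2 - W k3 k3)%:E
   + (d1 * W k3 k1 ^+ 2 + s * (2 * W k3 k1 * W k3 k2) + d2 * W k3 k2 ^+ 2)%:E
       / (W k3 k3)%:E
   <= (d1 * Y11 + s * (2 * W k1 k2) + d2 * Y22)%:E)%E.
Proof.
move=> dD s2 psdW c1 W11 l1 c2 W22 l2; have [/= d1_ge0 d2_ge0 _] := dD.
have -> : d1 * Y11 + s * (2 * W k1 k2) + d2 * Y22 =
    d1 * (Y11 - W k1 k1) + d2 * (Y22 - W k2 k2)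
    + (d1 * W k1 k1 + s * (2 * W k1 k2) + d2 * W k2 k2) by ring.
rewrite !EFinD; apply: leeD; last exact: perspective_pair_le.
by apply: leeD; apply: lee_scaled_div; rewrite // subr_ge0.
Qed.

Lemma fplus_le {R : realType} (d1 d2 x1 x2 y1 y2 Y11 Y12 Y22 : R) :
  calD (d1, d2) -> calW x1 x2 y1 y2 Y11 Y12 Y22 ->
  (fplus x1 x2 y1 y2 d1 d2 <= (d1 * Y11 + 2 * Y12 + d2 * Y22)%:E)%E.
Proof.
move=> dD [W [psdW [<- [[c1 W11 l1] [[c2 W22 l2] [/andP[z1 _] /andP[z2 _] l3]]]]]].
apply: ge_ereal_inf.
exists (fplus_obj y1 y2 d1 d2 x1 x2 (W k3 k1) (W k3 k2) (W k3 k3)).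
  exists (W k3 k1), (W k3 k2), (W k3 k3); split => //.
  by rewrite /lambda_range ge_max le_min psd_diag_ge0 // l3 l1 l2.
rewrite /fplus_obj -[2 * W k3 k1 * W k3 k2]mul1r -[2 * W k1 k2]mul1r.
by apply: pair_obj_le; rewrite ?expr1n.
Qed.

(** The same point as in [fplus_le]; the constraints on [z] now are the upper
    bounds [W31 <= y1] and [W32 <= y2] of [calW]. *)
Lemma fminus_le {R : realType} (d1 d2 x1 x2 y1 y2 Y11 Y12 Y22 : R) :
  calD (d1, d2) -> calW x1 x2 y1 y2 Y11 Y12 Y22 ->
  (fminus x1 x2 y1 y2 d1 d2 <= (d1 * Y11 - 2 * Y12 + d2 * Y22)%:E)%E.
Proof.
move=> dD [W [psdW [<- [[c1 W11 l1] [[c2 W22 l2] [/andP[_ z1] /andP[_ z2] l3]]]]]].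
apply: ge_ereal_inf.
exists (fminus_obj y1 y2 d1 d2 x1 x2 (W k3 k1) (W k3 k2) (W k3 k3)).
  exists (W k3 k1), (W k3 k2), (W k3 k3); split => //.
  by rewrite /lambda_range ge_max le_min psd_diag_ge0 // l3 l1 l2.
rewrite /fminus_obj -[- (2 * W k3 k1 * W k3 k2)]mulN1r -[- (2 * W k1 k2)]mulN1r.
by apply: pair_obj_le; rewrite ?sqrrN ?expr1n.
Qed.

(** * Frobenius products with sums of outer products *)

Lemma frob_outer {R : realType} {n : nat} (A : 'M[R]_n) (v : 'cV[R]_n) :
  frob A (v *m v^T) = qform A v.
Proof.
rewrite /frob /qform mxE exchange_big /=; apply: eq_bigr => j _.
rewrite mxE mulr_suml; apply: eq_bigr => i _.
by rewrite !mxE big_ord1 !mxE mulrA [A i j * _]mulrC.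
Qed.

Lemma frob_sum_outer {R : realType} {n : nat} (A : 'M[R]_n) (vs : seq 'cV[R]_n) :
  frob A (\sum_(v <- vs) v *m v^T) = \sum_(v <- vs) qform A v.
Proof.
under [RHS]eq_bigr do rewrite -frob_outer.
rewrite /frob [RHS]exchange_big /=; apply: eq_bigr => i _.
rewrite [RHS]exchange_big /=; apply: eq_bigr => j _.
by rewrite summxE mulr_sumr.
Qed.

Lemma sum_outerE {R : realType} {n : nat} (vs : seq 'cV[R]_n) i j :
  (\sum_(v <- vs) v *m v^T) i j = \sum_(v <- vs) v i 0 * v j 0.
Proof.
by rewrite summxE; apply: eq_bigr => v _; rewrite mxE big_ord1 mxE.
Qed.

Lemma frob_diag {R : realType} {n : nat} (D Y : 'M[R]_n) :
  is_diag_mx D -> frob D Y = \sum_i D i i * Y i i.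
Proof.
move=> /is_diag_mxP Ddiag; apply: eq_bigr => i _.
rewrite (bigD1 i) //= big1 ?addr0 // => j ji.
by rewrite Ddiag ?mul0r // eq_sym.
Qed.

(** Both sides are linear in [Y], and on an outer product [v *m v^T] they are
    the two sides of the identity of quadratic forms at [v]. *)
Lemma frob_decomposition {R : realType} {n : nat} {Q D Rm : 'M[R]_n}
    {P N : {set 'I_n * 'I_n}} {alpha beta gamma : 'I_n -> 'I_n -> R}
    {vs : seq 'cV[R]_n} :
  is_diag_mx D ->
  (forall y : 'cV[R]_n,
      qform Q y =
        qform D y
        + \sum_(p in P) alpha p.1 p.2 *
            (beta p.1 p.2 * y p.1 0 ^+ 2 + 2 * y p.1 0 * y p.2 0
             + gamma p.1 p.2 * y p.2 0 ^+ 2)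
        + \sum_(p in N) alpha p.1 p.2 *
            (beta p.1 p.2 * y p.1 0 ^+ 2 - 2 * y p.1 0 * y p.2 0
             + gamma p.1 p.2 * y p.2 0 ^+ 2)
        + qform Rm y) ->
  let Y := \sum_(v <- vs) v *m v^T in
  frob Q Y =
    \sum_i D i i * Y i i
    + \sum_(p in P) alpha p.1 p.2 *
        (beta p.1 p.2 * Y p.1 p.1 + 2 * Y p.1 p.2 + gamma p.1 p.2 * Y p.2 p.2)
    + \sum_(p in N) alpha p.1 p.2 *
        (beta p.1 p.2 * Y p.1 p.1 - 2 * Y p.1 p.2 + gamma p.1 p.2 * Y p.2 p.2)
    + frob Rm Y.
Proof.
move=> Ddiag Qdec Y; rewrite frob_sum_outer.
under eq_bigr do rewrite Qdec.
rewrite !big_split /= -(frob_diag D) // -!frob_sum_outer -/Y.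
congr (_ + _ + _ + _); rewrite exchange_big /=; apply: eq_bigr => p _.
- rewrite -mulr_sumr !sum_outerE; congr (_ * _).
  by rewrite !mulr_sumr -!big_split /=; apply: eq_bigr => v _; ring.
- rewrite -mulr_sumr !sum_outerE; congr (_ * _).
  by rewrite !mulr_sumr -sumrN -!big_split /=; apply: eq_bigr => v _; ring.
Qed.

(** * Comparison of the two relaxations *)

Theorem proposition8 (R : realType) (n : nat) (a b : 'cV[R]_n)
    (Q D Rm : 'M[R]_n) (P N : {set 'I_n * 'I_n})
    (alpha beta gamma : 'I_n -> 'I_n -> R)
    (hn : (2 <= n)%N)
    (hQ : psdmx Q)
    (hDdiag : is_diag_mx D) (hD : psdmx D)
    (hR : psdmx Rm)
    (hPN : [disjoint P & N])
    (hlt : forall p, p \in P :|: N -> (p.1 < p.2)%N)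
    (halpha : forall p, p \in P :|: N -> 0 < alpha p.1 p.2)
    (hbg : forall p, p \in P :|: N -> calD (beta p.1 p.2, gamma p.1 p.2))
    (hdec : forall y : 'cV[R]_n,
      qform Q y =
        qform D y
        + \sum_(p in P) alpha p.1 p.2 *
            (beta p.1 p.2 * y p.1 0 ^+ 2 + 2 * y p.1 0 * y p.2 0
             + gamma p.1 p.2 * y p.2 0 ^+ 2)
        + \sum_(p in N) alpha p.1 p.2 *
            (beta p.1 p.2 * y p.1 0 ^+ 2 - 2 * y p.1 0 * y p.2 0
             + gamma p.1 p.2 * y p.2 0 ^+ 2)
        + qform Rm y) :
  (decomp_val a b D Rm P N alpha beta gamma <= optpairs_val a b Q)%E.
Proof.
apply: le_ereal_inf_tmp => _ [x [y [Y [[_ psdS calWY box] ->]]]].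
apply: ge_ereal_inf; exists (decomp_obj a b D Rm P N alpha beta gamma x y).
  by exists x, y.
have [vs Svs] := psd_sum_outer _ psdS.
have Yvs : Y = \sum_(v <- y :: vs) v *m v^T by rewrite big_cons -Svs addrC subrK.
have Rm_le : qform Rm y <= frob Rm Y.
  rewrite Yvs frob_sum_outer big_cons lerDl sumr_ge0 // => v _; exact: hR.2.
have Ydiag i : 0 <= Y i i /\ y i 0 ^+ 2 <= Y i i * x i 0.
  (* n >= 2 provides a partner for the index i *)
  have [j ij] : exists j : 'I_n, j != i.
    have := hn; rewrite -[n in (2 <= n)%N]card_ord => /card_gt1P[j [k [_ _ jk]]].
    have [<-|ji] := eqVneq j i; last by exists j.
    by exists k; rewrite eq_sym.
  case: (ltngtP i j) => [lt|gt|/val_inj ij0].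
  - by have [] := calW_diag (calWY _ _ lt).
  - by have [] := calW_diag (calWY _ _ gt).
  - by rewrite ij0 eqxx in ij.
rewrite Yvs (frob_decomposition hDdiag hdec) -Yvs /decomp_obj.
rewrite !addrA [leRHS]EFinD; apply: leeD; last by rewrite lee_fin.
rewrite [leRHS]EFinD; apply: leeD; last rewrite -sumEFin.
rewrite [leRHS]EFinD; apply: leeD; last rewrite -sumEFin.
rewrite [leRHS]EFinD; apply: leeD => //; rewrite -sumEFin.
- apply: lee_sum => i _; rewrite [leRHS]EFinM; apply: lee_wpmul2l.
    by rewrite lee_fin psd_diag_ge0.
  have [Yii yY] := Ydiag i; have [/andP[x0 _] _] := box i.
  by apply: lee_div_fin; rewrite ?sqr_ge0.
- apply: lee_sum => p pP; have pPN : p \in P :|: N by rewrite inE pP.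
  rewrite [leRHS]EFinM; apply: lee_wpmul2l; first by rewrite lee_fin ltW ?halpha.
  by apply: fplus_le; [exact: hbg | exact/calWY/hlt].
- apply: lee_sum => p pN; have pPN : p \in P :|: N by rewrite inE pN orbT.
  rewrite [leRHS]EFinM; apply: lee_wpmul2l; first by rewrite lee_fin ltW ?halpha.
  by apply: fminus_le; [exact: hbg | exact/calWY/hlt].
Qed.
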